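(* For any $K_k$-minor-free (simple) graph $G$ of maximum degree $\Delta$, the fractional strong chromatic index of $G$ satisfies $\chi_{2,f}'(G)\le 2(k-1)(\Delta+1)$.
   Context: The fractional chromatic number $\chi_f(F)$ of a graph $F$ is the least total weight of a function $w$ from the stable sets of $F$ to $\mathbb{R}^+$ such that every vertex lies in stable sets of total weight at least $1$. The fractional strong chromatic index of $G$ is $\chi_{2,f}'(G)=\chi_f(L(G)^2)$, where $L(G)^2$ is the square of the line graph of $G$: its vertices are the edges of $G$, two being adjacent if they share an endpoint or are joined by an edge of $G$. *)

(* Defs.v *)
From HB Require Import structures.
From mathcomp Require Import all_boot all_order all_algebra.
From mathcomp Require Import classical_sets reals.

Set Implicit Arguments.
Unset Strict Implicit.
Unset Printing Implicit Defensive.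

Import Order.TTheory GRing.Theory Num.Theory.

Local Open Scope ring_scope.

Record sgraph := SGraph {
  vertex :> finType;
  adj : rel vertex;
  adj_sym : symmetric adj;
  adj_irrefl : irreflexive adj }.

Definition degree (G : sgraph) (x : G) : nat := #|[pred y | adj x y]|.

(* The maximum degree of the graph without vertices is 0. *)
Definition max_degree (G : sgraph) : nat := (\max_(x : G) degree x)%N.

Section Complete.
Variable k : nat.

Definition complete_rel : rel 'I_k := fun i j => i != j.

Lemma complete_sym : symmetric complete_rel.
Proof. by move=> i j; rewrite /complete_rel eq_sym. Qed.

Lemma complete_irrefl : irreflexive complete_rel.
Proof. by move=> i; rewrite /complete_rel eqxx. Qed.

Definition complete : sgraph := SGraph complete_sym complete_irrefl.
End Complete.

(* B is nonempty and the subgraph of G induced by B is connected. *)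
Definition connected_set (G : sgraph) (B : {set G}) : bool :=
  (B != finset.set0) &&
  [forall x in B, forall y in B,
     connect [rel u v | [&& u \in B, v \in B & adj u v]] x y].

(* H is a minor of G: the branch set phi x is contracted to the vertex x of H,
   and vertices and edges of G that are not needed are deleted. *)
Definition minor (H G : sgraph) : Prop :=
  exists phi : H -> {set G},
    [/\ forall x, connected_set (phi x),
        forall x y, x != y -> [disjoint phi x & phi y]
      & forall x y, adj x y ->
          exists u v, [/\ u \in phi x, v \in phi y & adj u v]].

Definition minor_free (H G : sgraph) : Prop := ~ minor H G.

Section Square.
Variable G : sgraph.

Definition square_rel : rel G :=
  fun x y => (x != y) && (adj x y || [exists z, adj x z && adj z y]).

Lemma square_sym : symmetric square_rel.
Proof.
move=> x y; rewrite /square_rel eq_sym adj_sym; congr (_ && (_ || _)).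
by apply: eq_existsb => z; rewrite andbC (adj_sym x) (adj_sym z).
Qed.

Lemma square_irrefl : irreflexive square_rel.
Proof. by move=> x; rewrite /square_rel eqxx. Qed.

Definition square : sgraph := SGraph square_sym square_irrefl.
End Square.

Section LineGraph.
Variable G : sgraph.

(* The edge xy is the two-element set [set x; y]. *)
Definition edges : {set {set G}} :=
  [set E : {set G} | [exists x, exists y, adj x y && (E == [set x; y])]].

Definition edge : finType := {E : {set G} | E \in edges}.

Definition line_rel : rel edge :=
  fun E F => (E != F) && ~~ [disjoint val E & val F].

Lemma line_sym : symmetric line_rel.
Proof. by move=> E F; rewrite /line_rel eq_sym disjoint_sym. Qed.

Lemma line_irrefl : irreflexive line_rel.
Proof. by move=> E; rewrite /line_rel eqxx. Qed.

Definition line_graph : sgraph := SGraph line_sym line_irrefl.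

(* Two edges are adjacent in the square of the line graph if and only if they
   are distinct and share an endpoint or are joined by an edge. *)
Lemma square_line_graphP (E F : edge) :
  reflect
    (E <> F /\ ((exists x, x \in val E /\ x \in val F) \/
                (exists x y, [/\ x \in val E, y \in val F & adj x y])))
    (@adj (square line_graph) E F).
Proof.
apply: (iffP andP) => [[/eqP nEF /orP adjEF]|[nEF adjEF]]; split=> //.
- case: adjEF => [/andP[_ /pred0Pn[x /andP[xE xF]]]|].
    by left; exists x.
  case/existsP=> D /andP[/andP[_ /pred0Pn[x /andP[xE xD]]]].
  case/andP=> _ /pred0Pn[y /andP[yD yF]].
  have [exy|nxy] := eqVneq x y; first by left; exists x; rewrite {2}exy.
  right; exists x, y; split=> //; move: xD yD nxy => /=.
  have := valP D; rewrite inE => /existsP[a /existsP[b /andP[ab /eqP->]]].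
  rewrite !inE => /orP[]/eqP-> /orP[]/eqP->; rewrite ?eqxx //.
  by rewrite adj_sym.
- exact/eqP.
have nEFb : E != F by exact/eqP.
have meet (A B : edge) x : x \in val A -> x \in val B ->
    ~~ [disjoint val A & val B].
  by move=> xA xB; apply/pred0Pn; exists x; apply/andP.
apply/orP; case: adjEF => [[x [xE xF]]|[x [y [xE yF xy]]]].
  by left; rewrite /= /line_rel nEFb (meet _ _ x).
have Dedge : [set x; y] \in edges.
  by rewrite inE; apply/existsP; exists x; apply/existsP; exists y;
    rewrite xy eqxx.
pose D : edge := Sub [set x; y] Dedge.
have xD : x \in val D by rewrite !inE eqxx.
have yD : y \in val D by rewrite !inE eqxx orbT.
have [ED|nED] := eqVneq E D.
  by left; rewrite /= /line_rel nEFb (meet _ _ y) // ED.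
have [DF|nDF] := eqVneq D F.
  by left; rewrite /= /line_rel nEFb (meet _ _ x) // -DF.
right; apply/existsP; exists D.
by rewrite /= /line_rel nED nDF (meet _ _ x) // (meet _ _ y).
Qed.
End LineGraph.

Definition stable (F : sgraph) (S : {set F}) : bool :=
  [forall x in S, forall y in S, ~~ adj x y].

Section FractionalChromaticNumber.
Variables (R : realType) (F : sgraph).

(* Only the values of w on stable sets matter. *)
Definition fractional_coloring (w : {set F} -> R) : Prop :=
  (forall S, stable S -> 0 <= w S) /\
  (forall v : F, 1 <= \sum_(S : {set F} | stable S && (v \in S)) w S).

Definition total_weight (w : {set F} -> R) : R :=
  \sum_(S : {set F} | stable S) w S.

Definition coloring_weights : set R :=
  [set total_weight w | w in fractional_coloring]%classic.

(* This infimum of a linear program over a nonempty polyhedron, with objective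
   bounded below by 0, is attained, so it is the least total weight. *)
Definition fractional_chromatic_number : R := inf coloring_weights.

Lemma has_inf_coloring_weights : has_inf coloring_weights.
Proof.
split; last first.
  exists 0 => _ [w [w0 _] <-]; exact: sumr_ge0.
exists (total_weight (fun=> 1)); exists (fun=> 1) => //.
split=> // v; have sv : stable [set v] && (v \in [set v]).
  rewrite set11 andbT; apply/forall_inP => x /set1P->.
  by apply/forall_inP => y /set1P->; rewrite adj_irrefl.
by rewrite (bigD1 [set v]%SET) //= lerDl sumr_ge0.
Qed.

Lemma fractional_chromatic_number_le (w : {set F} -> R) :
  fractional_coloring w -> fractional_chromatic_number <= total_weight w.
Proof.
by move=> fw; apply: ge_inf; [case: has_inf_coloring_weights | exists w].
Qed.
End FractionalChromaticNumber.

Definition fractional_strong_chromatic_index (R : realType) (G : sgraph) : R :=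
  fractional_chromatic_number R (square (line_graph G)).

(* Main.v *)
(** By Vizing's theorem the edges of [G] split into [Delta + 1] matchings.  Inside
    one matching, the square of the line graph is a minor of [G] (contract the
    edges of the matching), hence has no [K_k] minor, and its stable sets are
    induced matchings of [G].  It remains to combine the colour classes with the
    theorem of Reed and Seymour that a graph without [K_(h+1)] minor has
    fractional chromatic number at most [2 h].

    By linear programming duality it suffices to find, for all vertex weights,
    stable sets [A_1, ..., A_h] carrying together at least half of the weight.
    To this end one removes connected parts one after the other.  The earlier
    parts adjacent to a remaining component [C] are pairwise adjacent, so there
    are fewer than [h] of them, and the next part [X] in [C] can be given a colour
    that none of them has.  [X] is required to be adjacent to all of them, to
    contain a stable set of at least half of its weight, and to be maximal
    subject to this.  Such an [X] exists: a minimal connected set [D] in [C]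
    adjacent to all these earlier parts is bipartite, because by maximality of
    these parts two non-cut vertices of [D] are at even distance. *)

Require Import Defs.
From mathcomp Require Import all_boot all_order all_algebra.
From mathcomp Require Import reals ring lra zify.

Set Implicit Arguments.
Unset Strict Implicit.
Unset Printing Implicit Defensive.

Import Order.TTheory GRing.Theory Num.Theory.

(** * Distances and bipartite induced subgraphs *)

Section Distance.
Variables (T : finType) (e : rel T).

Definition walk n x y := [exists p : n.-tuple T, path e x p && (last x p == y)].

Lemma walkP n x y :
  reflect (exists p, [/\ path e x p, last x p = y & size p = n]) (walk n x y).
Proof.
apply: (iffP existsP) => [[p /andP[xp /eqP lp]]|[p [xp lp sp]]].
  by exists p; rewrite size_tuple.
by exists (tcast sp (in_tuple p)); rewrite val_tcast xp lp eqxx.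
Qed.

(** The search stops at [#|T|], which is therefore the value when no walk exists; a shortest path
    has fewer than [#|T|] steps. *)
Definition dist x y := find (fun n => walk n x y) (iota 0 #|T|).

Lemma dist_le p x y : path e x p -> last x p = y -> dist x y <= size p.
Proof.
move=> xp lp; have [ltp|lep] := ltnP (size p) #|T|; last first.
  by apply: leq_trans (find_size _ _) _; rewrite size_iota.
rewrite leqNgt; apply/negP => /(before_find 0); rewrite nth_iota // add0n.
by move/negbT/walkP; apply; exists p.
Qed.

Lemma geodesic x y : connect e x y ->
  exists p, [/\ path e x p, last x p = y & size p = dist x y].
Proof.
case/connectP=> p /shortenP[p' xp' up' _] ->{p}; set y' := last x p'.
have lt : size p' < #|T| 
  by rewrite -[_.+1]/(size (x :: p')) -(card_uniqP up') max_card.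
have hs : has (fun n => walk n x y') (iota 0 #|T|).
  by apply/hasP; exists (size p'); rewrite ?mem_iota //; apply/walkP; exists p'.
have := nth_find 0 hs; rewrite nth_iota ?add0n; first by move/walkP.
by rewrite -[X in _ < X](size_iota 0) -has_find.
Qed.

Lemma dist_self x : dist x x = 0.
Proof. by apply/eqP; rewrite -leqn0; apply: (@dist_le [::]). Qed.

Lemma dist_triangle x y z : connect e x y -> connect e y z ->
  dist x z <= dist x y + dist y z.
Proof.
move=> /geodesic[p [xp lp <-]] /geodesic[q [yq lq <-]].
by rewrite -size_cat dist_le ?cat_path ?last_cat ?lp ?xp.
Qed.

Lemma dist_adj x y : e x y -> x != y -> dist x y = 1.
Proof.
move=> xy nxy; have := @dist_le [:: y] x y; rewrite /= xy => /(_ isT erefl).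
rewrite leq_eqVlt ltnS leqn0 => /orP[/eqP//|/eqP d0].
have [p [xp lp]] := geodesic (connect1 xy); rewrite d0 => /size0nil p0.
by rewrite -lp p0 eqxx in nxy.
Qed.

(** A shorter walk to the end of [p], continued by [q], would shorten the whole geodesic. *)
Lemma geodesic_dist x p q : path e x (p ++ q) ->
  size (p ++ q) = dist x (last x (p ++ q)) -> dist x (last x p) = size p.
Proof.
rewrite cat_path last_cat => /andP[xp pq] sz; apply/eqP.
rewrite eqn_leq dist_le //= -(leq_add2r (size q)) -size_cat sz.
have xc : connect e x (last x p) by apply/connectP; exists p.
have cq : connect e (last x p) (last (last x p) q) by apply/connectP; exists q.
by apply: leq_trans (dist_triangle xc cq) _; rewrite leq_add2l dist_le.
Qed.

Hypothesis e_sym : symmetric e.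

Lemma walk_sym n x y : walk n x y = walk n y x.
Proof.
suff W a b : walk n a b -> walk n b a by apply/idP/idP; apply: W.
case/walkP=> p [ap lp sp]; apply/walkP; exists (rev (belast a p)).
split; last by rewrite size_rev size_belast.
- by rewrite -lp rev_path; under eq_path do rewrite e_sym.
- by case: p ap lp sp => [|c p] //= *; rewrite rev_cons last_rcons.
Qed.

Lemma dist_sym x y : dist x y = dist y x.
Proof. by apply: eq_find => n; rewrite walk_sym. Qed.
End Distance.

Section Connectivity.
Variable G : sgraph.
Implicit Types (A B C D X Y S : {set G}) (u v x y z : G).

Definition induced A : rel G := [rel u v | [&& u \in A, v \in A & adj u v]].

Lemma induced_sym A : symmetric (induced A).
Proof. by move=> u v; rewrite /induced /= andbCA adj_sym. Qed.

Lemma connect_induced_sym A : connect_sym (induced A).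
Proof. exact/sym_connect_sym/induced_sym. Qed.

Lemma connect_inducedS A B u v :
  A \subset B -> connect (induced A) u v -> connect (induced B) u v.
Proof.
move=> sAB; apply: connect_sub => x y /and3P[xA yA xy].
by apply: connect1; rewrite /induced /= !(subsetP sAB).
Qed.

Lemma induced_path_in A x p : x \in A -> path (induced A) x p -> all (mem A) p.
Proof. by elim: p x => //= y p IH x xA /andP[/and3P[_ yA _] /(IH _ yA)->]; rewrite yA. Qed.

Lemma path_avoid A x p z : x \in A -> path (induced A) x p ->
  z \notin x :: p -> path (induced (A :\ z)) x p.
Proof.
move=> xA xp zp; have pA := induced_path_in xA xp.
apply: (sub_in_path (P := [pred w | w != z]) (e := induced A)) xp.
  by move=> u v; rewrite !inE => uz vz /and3P[uA vA uv]; rewrite /induced /= !inE uz vz uA vA.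
by apply/allP => w wp; apply: contraNneq zp => <-.
Qed.

Lemma connected_setP A :
  reflect (A != set0 /\ {in A &, forall x y, connect (induced A) x y})
          (connected_set A).
Proof.
apply: (iffP andP) => -[A0 cA]; split=> //.
  by move=> x y xA yA; move/forall_inP/(_ x xA)/forall_inP: cA; apply.
by apply/forall_inP => x xA; apply/forall_inP => y yA; apply: cA.
Qed.

Definition noncut D x :=
  [forall u in D :\ x, forall v in D :\ x, connect (induced (D :\ x)) u v].

Lemma noncutP D x :
  reflect {in D :\ x &, forall u v, connect (induced (D :\ x)) u v} (noncut D x).
Proof.
apply: (iffP forall_inP) => [cD u v uD vD|cD u uD].
  by move/forall_inP: (cD u uD); apply.
by apply/forall_inP => v vD; apply: cD.
Qed.

Section Bipartite.
Variable D : {set G}.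
Hypothesis cD : {in D &, forall x y, connect (induced D) x y}.
Local Notation d := (dist (induced D)).

(* Among the vertices separated from [u] by [v], one at maximum distance from
   [v] is not a cut vertex. *)
Lemma noncut_beyond_cut u v : u \in D :\ v -> v \in D -> ~~ noncut D v ->
  exists z, [/\ z \in D :\ v, noncut D z & ~~ connect (induced (D :\ v)) u z].
Proof.
move=> uD vD /forall_inPn[a aD] /forall_inPn[b bD ab].
pose K := [pred y | (y \in D :\ v) && ~~ connect (induced (D :\ v)) u y].
have [k kK] : exists k, K k.
  have [ua|nua] := boolP (connect (induced (D :\ v)) u a); last first.
    by exists a; rewrite /= aD.
  exists b; rewrite /= bD; apply: contra ab => ub.
  by apply: connect_trans ub; rewrite connect_induced_sym.
case: (arg_maxnP (d v) kK) => z /andP[zD uz] zmax.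
have /setD1P[zv zD'] := zD.
exists z; split=> //; apply/noncutP.
suff C : {in D :\ z, forall y, connect (induced (D :\ z)) v y}.
  move=> x y xD yD; apply: connect_trans (C y yD).
  by rewrite connect_induced_sym C.
move=> y /setD1P[yz yD].
have [p [vp lp sp]] := geodesic (cD vD yD).
have [zp|zp] := boolP (z \in v :: p); last first.
  by apply/connectP; exists p => //; apply: path_avoid.
move: zp; rewrite inE (negPf zv) /= => zp.
case/splitPr: {2}p / zp (erefl p) => p1 p2 Ep.
have dz : d v z = (size p1).+1.
  have := @geodesic_dist _ (induced D) v (rcons p1 z) p2.
  by rewrite cat_rcons -Ep last_rcons size_rcons lp => -> //.
have p20 : p2 != [::].
  by apply: contraNneq yz => p20; rewrite -lp Ep p20 last_cat.
have dy : d v y = (size p1 + (size p2).+1)%N by rewrite -sp Ep size_cat.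
(* Beyond [z] the geodesic never returns to [v], so it joins [z] to [y] inside [D :\ v]. Hence [y]
   is also separated from [u], yet farther from [v] than [z]. *)
have Ky : K y.
  have vy : y != v by apply: contra_eqN dy => /eqP->; rewrite dist_self addnS.
  rewrite /= !inE vy yD /=; apply: contra uz => uy; apply: connect_trans uy _.
  rewrite connect_induced_sym; apply/connectP; exists p2.
    apply: path_avoid => //.
      by move: vp; rewrite Ep cat_path /= => /and3P[_ _].
    rewrite inE eq_sym negb_or zv; apply/negP => vp2.
    case/splitPr: {2}p2 / vp2 (erefl p2) => q1 q2 Eq.
    have := @geodesic_dist _ (induced D) v (p1 ++ z :: rcons q1 v) q2.
    rewrite -catA cat_cons cat_rcons -Eq -Ep lp => /(_ vp sp).
    by rewrite last_cat /= last_rcons dist_self size_cat addnS.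
  by move: lp; rewrite Ep last_cat.
have := zmax y Ky; rewrite dz dy /= addnS ltnS -[X in _ <= X]addn0 leq_add2l.
by rewrite leqn0 size_eq0 (negPf p20).
Qed.

(** A geodesic from [u] to [z] must pass through [v], where it splits into two walks. *)
Lemma dist_through_cut u v z : u \in D -> z \in D -> v \in D ->
  ~~ connect (induced (D :\ v)) u z -> d u z = (d u v + d v z)%N.
Proof.
move=> uD zD vD nuz; apply/eqP; rewrite eqn_leq dist_triangle ?cD //=.
have [p [up lp <-]] := geodesic (cD uD zD).
have [vp|vp] := boolP (v \in u :: p); last first.
  by case/negP: nuz; apply/connectP; exists p => //; apply: path_avoid.
move: vp; rewrite inE => /predU1P[Ev|vp].
  by subst v; rewrite dist_self dist_le.
case/splitPr: p / vp up lp => p1 p2; rewrite cat_path last_cat /=.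
case/and3P=> up1 pv vp2 lp; rewrite size_cat /= addnS -addSn leq_add //.
  by rewrite -(size_rcons p1 v) dist_le ?rcons_path ?up1 ?last_rcons.
exact: dist_le.
Qed.

Hypothesis even_noncut : {in D &, forall z1 z2,
  noncut D z1 -> noncut D z2 -> ~~ odd (d z1 z2)}.

(** If [v] separates two non-cut vertices, their distances to [v] add up to an even number. Two
    non-cut vertices on the same side of [v] are both compared with a third one on another side. *)
Lemma noncut_parity v z1 z2 : v \in D -> z1 \in D -> z2 \in D ->
  noncut D z1 -> noncut D z2 -> odd (d v z1) = odd (d v z2).
Proof.
move=> vD z1D z2D n1 n2.
have [nv|cv] := boolP (noncut D v).
  by rewrite !(negPf (even_noncut _ _ _ _)).
have zv z : noncut D z -> z != v by apply: contraTneq => ->.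
have sep a b : a \in D -> b \in D -> noncut D a -> noncut D b ->
    ~~ connect (induced (D :\ v)) a b -> odd (d v a) = odd (d v b).
  move=> aD bD na nb nab; have := even_noncut aD bD na nb.
  rewrite (dist_through_cut _ _ vD nab) // oddD (dist_sym (@induced_sym D) a).
  by case: (odd _); case: (odd _).
have z1v : z1 \in D :\ v by rewrite !inE zv.
have [z3 [/setD1P[_ z3D] n3 n13]] := noncut_beyond_cut z1v vD cv.
have [c12|] := boolP (connect (induced (D :\ v)) z1 z2); last exact: sep.
rewrite (sep z1 z3) // (sep z2 z3) //; apply: contra n13.
exact: connect_trans.
Qed.

(** Colour by the parity of the distance to a non-cut vertex [z]. By [noncut_parity], [z] may be
    replaced for an edge [uv] by [v] itself, or by a non-cut vertex that the cut vertex [v]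
    separates from [u]; there the two distances differ by one. Without non-cut vertices there are no
    edges. *)
Lemma bipartite_of_even_noncut :
  exists c : pred G, {in D &, forall u v, adj u v -> c u != c v}.
Proof.
have [/existsP[z /andP[zD nz]]|/existsPn noz] :=
  boolP [exists z, (z \in D) && noncut D z]; last first.
  exists pred0 => u v uD vD uv; have vu : u != v.
    by apply: contraTneq uv => ->; rewrite adj_irrefl.
  have nv : ~~ noncut D v by have := noz v; rewrite vD.
  have uDv : u \in D :\ v by rewrite !inE vu.
  have [z [/setD1P[_ zD] nz _]] := noncut_beyond_cut uDv vD nv.
  by have := noz z; rewrite zD nz.
exists (fun v => odd (d v z)) => u v uD vD uv.
have uDv : u \in D :\ v.
  by rewrite !inE uD andbT; apply: contraTneq uv => ->; rewrite adj_irrefl.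
have duv : d u v = 1%N.
  by case/setD1P: uDv => nuv _; rewrite dist_adj // /induced /= uD vD.
have [nv|cv] := boolP (noncut D v).
  rewrite (negPf (even_noncut vD zD nv nz)).
  by rewrite -(noncut_parity uD vD zD) // duv.
have [z' [/setD1P[_ z'D] nz' uz']] := noncut_beyond_cut uDv vD cv.
rewrite (noncut_parity uD zD z'D) // (noncut_parity vD zD z'D) //.
by rewrite (dist_through_cut uD z'D vD uz') duv oddD /=; case: (odd _).
Qed.

End Bipartite.

(** * Adjacent sets, stable sets and components *)

Definition joined A B := [exists u in A, exists v in B, adj u v].

Lemma joinedP A B :
  reflect (exists u v, [/\ u \in A, v \in B & adj u v]) (joined A B).
Proof.
apply: (iffP exists_inP) => [[u uA /exists_inP[v vB uv]]|[u [v [uA vB uv]]]].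
  by exists u, v.
by exists u => //; apply/exists_inP; exists v.
Qed.

Lemma joinedS A A' B B' :
  A \subset A' -> B \subset B' -> joined A B -> joined A' B'.
Proof.
move=> /subsetP sA /subsetP sB /joinedP[u [v [uA vB uv]]].
by apply/joinedP; exists u, v; rewrite sA ?sB.
Qed.

Lemma joined_sym A B : joined A B = joined B A.
Proof.
by apply/joinedP/joinedP => -[u [v [uA vB uv]]]; exists v, u; rewrite adj_sym.
Qed.

Lemma joinedUr A B C : joined A (B :|: C) = joined A B || joined A C.
Proof.
apply/idP/orP => [/joinedP[u [v [uA /setUP[vB|vC] uv]]]|[]].
- by left; apply/joinedP; exists u, v.
- by right; apply/joinedP; exists u, v.
- exact/joinedS/subsetUl.
- exact/joinedS/subsetUr.
Qed.

Lemma stableP S :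
  reflect {in S &, forall x y, ~~ adj x y} (stable S).
Proof.
apply: (iffP forall_inP) => [st x y xS yS|st x xS].
  by move/forall_inP: (st x xS); apply.
by apply/forall_inP => y yS; apply: st.
Qed.

Lemma stable_set0 : stable (set0 : {set G}).
Proof. by apply/stableP => x y; rewrite inE. Qed.

Lemma stableU A B : stable A -> stable B -> ~~ joined A B -> stable (A :|: B).
Proof.
move=> /stableP sA /stableP sB nAB; apply/stableP => x y.
case/setUP=> [xA|xB] /setUP[yA|yB]; [exact: sA | | | exact: sB].
  by apply: contra nAB => xy; apply/joinedP; exists x, y.
by apply: contra nAB => xy; apply/joinedP; exists y, x; rewrite adj_sym.
Qed.

Lemma connected_setU A B :
  connected_set A -> connected_set B -> joined A B -> connected_set (A :|: B).
Proof.
move=> /connected_setP[A0 cA] /connected_setP[B0 cB] /joinedP[u [v [uA vB uv]]].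
have cu : {in A :|: B, forall x, connect (induced (A :|: B)) u x}.
  move=> x /setUP[xA|xB].
    exact: connect_inducedS (subsetUl A B) (cA _ _ uA xA).
  apply: connect_trans (connect_inducedS (subsetUr A B) (cB _ _ vB xB)).
  by apply: connect1; rewrite /induced /= !inE uA vB uv orbT.
apply/connected_setP; split.
  by apply: contraNneq A0 => AB0; rewrite -subset0 -AB0 subsetUl.
move=> x y xAB yAB; apply: connect_trans (cu y yAB).
by rewrite connect_induced_sym cu.
Qed.

Lemma connected_of_paths x A : x \in A ->
  {in A, forall y, exists2 p, path (@adj G) x p /\ last x p = y & {subset p <= A}} ->
  connected_set A.
Proof.
move=> xA pA; have cx : {in A, forall y, connect (induced A) x y}.
  move=> y /pA[p [xp lp] sp]; apply/connectP; exists p => //.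
  apply: (sub_in_path (P := mem A) (e := @adj G)) xp.
    by move=> u v uA vA uv; rewrite /induced /= uA vA.
  by apply/allP => z; rewrite inE => /predU1P[->|/sp].
apply/connected_setP; split; first by apply/set0Pn; exists x.
move=> u v uA vA; apply: connect_trans (cx v vA).
by rewrite connect_induced_sym cx.
Qed.

Lemma induced_path A x p : path (induced A) x p -> path (@adj G) x p.
Proof. by apply: sub_path => u v /and3P[]. Qed.

Lemma component_exists A : A != set0 ->
  exists C, [/\ connected_set C, C \subset A & ~~ joined C (A :\: C)].
Proof.
case/set0Pn=> x xA; pose C := [set y in A | connect (induced A) x y].
exists C; split; last 2 first.
- by apply/subsetP => y; rewrite inE => /andP[].
- apply/negP => /joinedP[u [v []]]; rewrite !inE => /andP[uA xu] /andP[nv vA] uv.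
  case/negP: nv; rewrite vA; apply: connect_trans xu (connect1 _).
  by rewrite /induced /= uA vA.
have xC : x \in C by rewrite inE xA connect0.
apply: (connected_of_paths xC) => y; rewrite inE => /andP[yA /connectP[p xp ->]].
exists p; first by split=> //; apply: induced_path xp.
move=> z zp; have zA : z \in A := allP (induced_path_in xA xp) z zp.
rewrite inE zA /=.
by apply: (path_connect xp); rewrite inE zp orbT.
Qed.

(** [Y] is the vertex set of a geodesic, coloured by the parity of the distance from [z1]. This
    distance is injective on [Y] and changes by at most one along an edge, hence by exactly one. *)
Lemma odd_geodesic D z1 z2 : connected_set D -> z1 \in D -> z2 \in D ->
  odd (dist (induced D) z1 z2) ->
  exists Y (c : pred G), [/\ connected_set Y /\ Y \subset D,
    z1 \in Y /\ z2 \in Y, ~~ c z1 /\ c z2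
    & {in Y &, forall u v, adj u v -> c u != c v}].
Proof.
move=> /connected_setP[_ cD] z1D z2D odd12; set d := dist (induced D) in odd12.
have [p [zp lp sp]] := geodesic (cD _ _ z1D z2D).
pose Y := [set y in z1 :: p].
have YD : {subset Y <= D}.
  move=> y; rewrite inE in_cons => /predU1P[-> //|yp].
  exact: (allP (induced_path_in z1D zp)).
have prefix y : y \in Y ->
    exists q, [/\ d z1 y = size q, last z1 q = y & q = take (size q) p].
  rewrite inE => yp; case/splitPl: yp zp lp sp => q r lq zqr lqr sqr.
  exists q; rewrite take_size_cat //; split=> //.
  by rewrite /d -lq (@geodesic_dist _ _ _ _ r) // lqr.
have dinj : {in Y &, injective (d z1)}.
  move=> y y' /prefix[q [-> lq eq]] /prefix[q' [-> lq' eq']] ss.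
  by rewrite -lq -lq' eq eq' ss.
exists Y, (fun y => odd (d z1 y)); split.
- split; last exact/subsetP.
  apply: (@connected_of_paths z1); first by rewrite inE mem_head.
  move=> y; rewrite inE => yp; case/splitPl: yp zp @Y {prefix dinj YD lp sp}.
  move=> q r lq; rewrite cat_path => /andP[zq _] Y.
  exists q; first by split=> //; apply: induced_path zq.
  by move=> u uq; rewrite !inE mem_cat uq orbT.
- by split; rewrite inE -?lp (mem_head, mem_last).
- by rewrite /d dist_self.
move=> u v uY vY uv; have nuv : u != v.
  by apply: contraTneq uv => ->; rewrite adj_irrefl.
have tri x y : x \in D -> y \in D -> adj x y -> x != y -> d z1 y <= (d z1 x).+1.
  move=> xD yD xy nxy; rewrite -addn1 -(@dist_adj _ (induced D) x y) //.
    by rewrite dist_triangle ?cD.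
  by rewrite /induced /= xD yD.
have := tri u v (YD _ uY) (YD _ vY) uv nuv.
rewrite adj_sym eq_sym in uv nuv.
have := tri v u (YD _ vY) (YD _ uY) uv nuv.
have : d z1 u != d z1 v by apply: contra_neq nuv => /esym/dinj->.
by clear; lia.
Qed.

(** * The theorem of Reed and Seymour *)

Section Weighted.
Variables (R : realDomainType) (w : G -> R).

Definition weight A : R := (\sum_(v in A) w v)%R.

Lemma weightU A B : [disjoint A & B] -> weight (A :|: B) = (weight A + weight B)%R.
Proof. move=> dAB; rewrite /weight -bigU //=; apply: eq_bigl => x.
by rewrite inE. Qed.

Lemma weight_split A B : B \subset A -> weight A = (weight B + weight (A :\: B))%R.
Proof. by move=> sBA; rewrite /weight (big_setID B) /= (setIidPr sBA). Qed.

Definition half_stable X := [exists S : {set G},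
  [&& S \subset X, stable S & (weight X <= 2 * weight S)%R]].

Lemma half_stableP X : reflect
  (exists S, [/\ S \subset X, stable S & (weight X <= 2 * weight S)%R])
  (half_stable X).
Proof.
by apply: (iffP existsP) => -[S]; [case/and3P | case] => *; exists S; [|apply/and3P].
Qed.

Lemma weight_bicolor A (c : pred G) :
  weight A = (weight [set y in A | c y] + weight [set y in A | ~~ c y])%R.
Proof.
rewrite (weight_split (B := [set y in A | c y])).
  by congr (_ + weight _)%R; apply/setP => y; rewrite !inE; case: (y \in A); case: (c y).
by apply/subsetP => y; rewrite inE => /andP[].
Qed.

Lemma stable_bicolor A (c : pred G) b :
  {in A &, forall u v, adj u v -> c u != c v} ->
  stable [set y in A | c y == b].
Proof.
move=> cA; apply/stableP => u v; rewrite !inE => /andP[uA /eqP cu] /andP[vA /eqP cv].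
by apply/negP => /(cA _ _ uA vA); rewrite cu cv eqxx.
Qed.

Lemma half_stable_bipartite A (c : pred G) :
  {in A &, forall u v, adj u v -> c u != c v} -> half_stable A.
Proof.
move=> cA; have := weight_bicolor A c.
have s1 := stable_bicolor true cA; have s2 := stable_bicolor false cA.
have -> : [set y in A | c y] = [set y in A | c y == true].
  by apply/setP => y; rewrite !inE eqb_id.
have -> : [set y in A | ~~ c y] = [set y in A | c y == false].
  by apply/setP => y; rewrite !inE eqbF_neg.
move=> wA; apply/half_stableP.
have sub b : [set y in A | c y == b] \subset A.
  by apply/subsetP => y; rewrite inE => /andP[].
have [le|lt] := lerP (weight A) (2 * weight [set y in A | c y == true])%R.
  by exists [set y in A | c y == true].
exists [set y in A | c y == false]; split=> //.
by rewrite wA in lt *; lra.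
Qed.

(* The parts of the decomposition adjacent to a region [C], indexed by their
   colours; [B i = set0] when colour [i] is not used around [C]. *)
Section Region.
Variables (h : nat) (B : 'I_h -> {set G}).

Definition hits X := [forall i, (B i != set0) ==> joined (B i) X].

Lemma hitsP X : reflect (forall i, B i != set0 -> joined (B i) X) (hits X).
Proof.
by apply: (iffP forallP) => H i; [move/implyP: (H i) | apply/implyP; apply: H].
Qed.

(* Maximality of the part [P]: attaching the connected set [Y] to it, with the
   stable set [T] of [Y], would give a larger half-stable part. *)
Definition unextendable C P := forall Y T : {set G}, connected_set Y -> Y \subset C ->
  joined P Y -> T \subset Y -> stable T -> ~~ joined P T ->
  (2 * weight T < weight Y)%R.

(* In a minimal connected set hitting all the [B i], each non-cut vertex is the
   only one adjacent to some [B i].  If two of them were joined by a geodesic of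
   odd length, the heavier colour class of this path would contain only one of
   its ends and could be attached to the [B i] of the other end. *)
Lemma hitting_half_stable C : connected_set C -> hits C ->
  (forall i, B i != set0 -> unextendable C (B i)) ->
  exists X, [/\ connected_set X, X \subset C, hits X & half_stable X].
Proof.
move=> cC hC unB; pose P X := [&& connected_set X, X \subset C & hits X].
have PC : P C by rewrite /P cC subxx.
have [D /minsetP[/and3P[cD sDC hD] minD] _] := minset_exists PC.
exists D; split=> //; have /connected_setP[_ cD'] := cD.
suff ev : {in D &, forall z1 z2, noncut D z1 -> noncut D z2 ->
    ~~ odd (dist (induced D) z1 z2)}.
  by have [c /half_stable_bipartite] := bipartite_of_even_noncut cD' ev.
move=> z1 z2 z1D z2D n1 n2; have [<-|n12] := eqVneq z1 z2.
  by rewrite dist_self.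
have private z z' : z \in D -> z' \in D -> noncut D z -> z' != z ->
    exists i, [/\ B i != set0, ~~ joined (B i) (D :\ z) &
      forall Y, z \in Y -> joined (B i) Y].
  move=> zD z'D nz zz'.
  have cDz : connected_set (D :\ z).
    apply/connected_setP; split; last exact/noncutP.
    by apply/set0Pn; exists z'; rewrite !inE zz'.
  have /forallPn[i] : ~~ hits (D :\ z).
    apply/negP => hz; have := minD (D :\ z).
    rewrite /P cDz hz (subset_trans (subsetDl _ _) sDC) subsetDl => /(_ isT isT).
    by move/setP/(_ z); rewrite !inE eqxx zD.
  rewrite negb_imply => /andP[Bi nj]; exists i; split=> // Y zY.
  have /joinedP[u [v [uB vD uv]]] := hitsP _ hD i Bi.
  apply/joinedP; exists u, v; split=> //.
  have [-> //|vz] := eqVneq v z.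
  by case/negP: nj; apply/joinedP; exists u, v; rewrite !inE vz.
have [i1 [Bi1 nj1 j1]] := private z1 z2 z1D z2D n1 ltac:(by rewrite eq_sym).
have [i2 [Bi2 nj2 j2]] := private z2 z1 z2D z1D n2 n12.
apply/negP => /(odd_geodesic cD z1D z2D).
case=> Y [c [[cY sYD] [z1Y z2Y] [c1 c2] cYY]].
have sub b : [set y in Y | c y == b] \subset Y.
  by apply/subsetP => y; rewrite inE => /andP[].
(* The class avoiding [z1] is tried on [B i1] and the class avoiding [z2] on [B i2]; the two strict
   bounds contradict that the classes partition [Y]. *)
have w1 := unB i1 Bi1 Y [set y in Y | c y == true] cY (subset_trans sYD sDC)
  (j1 Y z1Y) (sub _) (stable_bicolor _ cYY).
have w2 := unB i2 Bi2 Y [set y in Y | c y == false] cY (subset_trans sYD sDC)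
  (j2 Y z2Y) (sub _) (stable_bicolor _ cYY).
have avoid b z i : c z != b -> ~~ joined (B i) (D :\ z) ->
    ~~ joined (B i) [set y in Y | c y == b].
  move=> cz; apply/contra/joinedS => //; apply/subsetP => y.
  rewrite !inE => /andP[/(subsetP sYD)-> /eqP cy]; rewrite andbT.
  by apply: contra_neq cz => <-.
have := w1 (avoid _ _ _ _ nj1); rewrite (negPf c1) => /(_ isT).
have := w2 (avoid _ _ _ _ nj2); rewrite c2 => /(_ isT).
have := weight_bicolor Y c.
have -> : [set y in Y | c y] = [set y in Y | c y == true].
  by apply/setP => y; rewrite !inE eqb_id.
have -> : [set y in Y | ~~ c y] = [set y in Y | c y == false].
  by apply/setP => y; rewrite !inE eqbF_neg.
lra.
Qed.

(** Take [X] inclusion-maximal. A set [Y] violating [unextendable] would make [X :|: Y] half-stable,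
    through the union of the two stable sets. *)
Lemma maximal_half_stable C : connected_set C -> hits C ->
  (forall i, B i != set0 -> unextendable C (B i)) ->
  exists X, [/\ connected_set X, X \subset C, hits X, half_stable X
              & unextendable (C :\: X) X].
Proof.
move=> cC hC unB; have [X0 [cX0 sX0 hX0 wX0]] := hitting_half_stable cC hC unB.
pose P X := [&& connected_set X, X \subset C, hits X & half_stable X].
have PX0 : P X0 by rewrite /P cX0 sX0 hX0.
have [X /maxsetP[/and4P[cX sX hX wX] maxX] _] := maxset_exists PX0.
exists X; split=> // Y T cY sY jXY sT stT nj; rewrite ltNge; apply/negP => wY.
have [S [sS stS wS]] := half_stableP _ wX.
have dXY : [disjoint X & Y].
  by rewrite disjoint_sym disjoints_subset (subset_trans sY) // subsetDr.
have dST : [disjoint S & T] by apply: disjointWl sS (disjointWr sT dXY).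
have PXY : P (X :|: Y).
  rewrite /P connected_setU // subUset sX (subset_trans sY (subsetDl _ _)) /=.
  apply/andP; split.
    by apply/hitsP => i /(hitsP _ hX); apply: joinedS; rewrite ?subsetUl.
  apply/half_stableP; exists (S :|: T); split; first exact: setUSS.
    by apply: stableU => //; apply: contra nj; apply: joinedS.
  by rewrite (weightU dXY) (weightU dST) mulrDr lerD.
have YX : Y \subset X by rewrite -(maxX _ PXY (subsetUl X Y)) subsetUr.
case/connected_setP: cY => /set0Pn[y yY] _.
by have := disjointFr dXY (subsetP YX y yY); rewrite yY.
Qed.

(** The condition on [B i] allows colour [i] to be united with a stable set chosen inside the part
    [B i]. *)
Definition colorable C := exists A : 'I_h -> {set G},
  [/\ forall i, A i \subset C, forall i, stable (A i),
      forall i, ~~ joined (B i) (A i)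
    & (weight C <= 2 * \sum_i weight (A i))%R].

Lemma colorableU C1 C2 : [disjoint C1 & C2] -> ~~ joined C1 C2 ->
  colorable C1 -> colorable C2 -> colorable (C1 :|: C2).
Proof.
move=> d12 n12 [A1 [s1 st1 b1 w1]] [A2 [s2 st2 b2 w2]].
exists (fun i => A1 i :|: A2 i); split=> [i|i|i|].
- exact: setUSS.
- by apply: stableU => //; apply: contra n12; apply: joinedS.
- by rewrite joinedUr negb_or b1 b2.
rewrite weightU // (eq_bigr (fun i => weight (A1 i) + weight (A2 i))%R).
  by rewrite big_split /= mulrDr lerD.
by move=> i _; rewrite weightU //; apply: disjointWl (s1 i) (disjointWr (s2 i) d12).
Qed.

(** Components are split off one at a time; no edge joins them, so their colour classes can be
    united. *)
Lemma colorable_components A :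
  (forall C, connected_set C -> C \subset A -> ~~ joined C (A :\: C) -> colorable C) ->
  colorable A.
Proof.
have [n] := ubnP #|A|; elim: n A => // n IH A ltn cA.
have [A0|/component_exists[C [cC sC nC]]] := eqVneq A set0.
  exists (fun=> set0); split=> [i|i|i|]; rewrite ?sub0set ?stable_set0 //.
    by apply/joinedP => -[u [v []]]; rewrite inE.
  by rewrite A0 /weight big_set0 mulr_ge0 ?sumr_ge0 // => i _; rewrite big_set0.
have EA : A = C :|: (A :\: C) by rewrite -{1}(setIidPr sC) setID.
rewrite EA; apply: colorableU => //.
- by rewrite disjoint_sym disjoints_subset subsetDr.
- exact: cA.
apply: IH => [|C' cC' sC' nC'].
  rewrite -ltnS; apply: leq_trans ltn; rewrite ltnS; apply/proper_card.
  rewrite properE subsetDl; case/connected_setP: cC => /set0Pn[x xC] _.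
  apply/subsetPn; exists x; first exact: (subsetP sC).
  by rewrite inE xC.
apply: cA => //; first exact: subset_trans sC' (subsetDl _ _).
apply: contra nC' => /joinedP[u [v [uC' /setDP[vA vC'] uv]]].
apply/joinedP; exists u, v; split=> //; rewrite !inE vC' vA andbT.
apply: contra nC => vC; apply/joinedP; exists v, u; split; rewrite 1?adj_sym //.
exact: (subsetP sC').
Qed.

End Region.

(** * Complete minor models and the recursion on regions *)

Definition complete_model k (U : {set G}) := exists phi : 'I_k -> {set G},
  [/\ forall i, connected_set (phi i), forall i, phi i \subset U,
      forall i j, i != j -> [disjoint phi i & phi j]
    & forall i j, i != j -> joined (phi i) (phi j)].

Definition boundary h (U : {set G}) (B : 'I_h -> {set G}) (C : {set G}) :=
  [/\ forall i, B i != set0 ->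
        [/\ connected_set (B i), B i \subset U, [disjoint B i & C]
          & unextendable C (B i)],
      hits B C
    & forall i j, i != j -> B i != set0 -> B j != set0 ->
        [disjoint B i & B j] /\ joined (B i) (B j)].

(** When all [h] colours are used around [C], the region itself, put at index [ord_max], is one more
    set adjacent to all the others. *)
Lemma boundary_model h (U : {set G}) (B : 'I_h -> {set G}) C :
  connected_set C -> C \subset U -> boundary U B C ->
  (forall i, B i != set0) -> complete_model h.+1 U.
Proof.
move=> cC sC [B1 hB B2] B0.
exists (fun i => if unlift ord_max i is Some j then B j else C).
split=> [i|i|i j nij|i j nij].
- by case: unliftP => [j|] _ //; case: (B1 j (B0 j)).
- by case: unliftP => [j|] _ //; case: (B1 j (B0 j)).
- case: unliftP nij => [i'|] ->; case: unliftP => [j'|] -> nij.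
  + by case: (B2 i' j'); rewrite // -(inj_eq (lift_inj (h := ord_max))).
  + by case: (B1 i' (B0 i')).
  + by rewrite disjoint_sym; case: (B1 j' (B0 j')).
  + by rewrite eqxx in nij.
- case: unliftP nij => [i'|] ->; case: unliftP => [j'|] -> nij.
  + by case: (B2 i' j'); rewrite // -(inj_eq (lift_inj (h := ord_max))).
  + exact: (hitsP _ _ hB).
  + by rewrite joined_sym (hitsP _ _ hB).
  + by rewrite eqxx in nij.
Qed.

Lemma unextendableS C C' P : C' \subset C -> unextendable C P -> unextendable C' P.
Proof. by move=> sC unC Y T cY /subset_trans/(_ sC); apply: unC. Qed.

(* The new part [X] gets a colour [i0] not used around [C]; each component of
   [C :\: X] is again surrounded by pairwise adjacent parts of distinct colours. *)
Lemma region_colorable h (U : {set G}) (B : 'I_h -> {set G}) C :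
  ~ complete_model h.+1 U -> connected_set C -> C \subset U -> boundary U B C ->
  colorable B C.
Proof.
move=> noK; have [n] := ubnP #|C|; elim: n B C => // n IH B C ltn cC sCU bC.
have [/existsP[i0 /eqP Bi0]|/existsPn allB] := boolP [exists i, B i == set0]; last first.
  by case: noK; apply: boundary_model bC allB.
have [B1 hB B2] := bC.
have unB i : B i != set0 -> unextendable C (B i) by case/B1.
have [X [cX sX hX /half_stableP[S [sSX stS wS]] unX]] := maximal_half_stable cC hB unB.
pose B' i := if i == i0 then X else B i.
have [A [sA stA nA wA]] : colorable B' (C :\: X).
  apply: colorable_components => C' cC' sC' _.
  (* Parts not adjacent to [C'] are emptied, as [hits] requires; subsets of [C'] avoid them
     anyway. *)
  pose B'' i := if joined (B' i) C' then B' i else set0.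
  have sC'C : C' \subset C := subset_trans sC' (subsetDl _ _).
  suff bC' : boundary U B'' C'.
    have ltC' : #|C'| < n.
      rewrite -ltnS; apply: leq_trans ltn; rewrite ltnS; apply: proper_card.
      rewrite properE sC'C; case/connected_setP: cX => /set0Pn[x xX] _.
      apply/subsetPn; exists x; first exact: (subsetP sX).
      by apply: contraL xX => /(subsetP sC'); rewrite inE => /andP[].
    have [A [sA stA nA wA]] := IH B'' C' ltC' cC' (subset_trans sC'C sCU) bC'.
    exists A; split=> // i; have := nA i; rewrite /B''; case: ifP => // nj _.
    by apply/negP => /(joinedS (subxx _) (sA i)); rewrite nj.
  have joinedB'' i : B'' i != set0 -> B'' i = B' i /\ joined (B' i) C'.
    by rewrite /B''; case: ifP => //; rewrite eqxx.
  have dX i : B i != set0 -> [disjoint X & B i] /\ joined X (B i).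
    move=> Bi; have [_ _ dBC _] := B1 i Bi; split.
      by rewrite disjoint_sym; apply: disjointWr dBC.
    by rewrite joined_sym (hitsP _ _ hX).
  have B'0 i : B' i != set0 -> i != i0 -> B' i = B i /\ B i != set0.
    by rewrite /B' => + /negPf ni; rewrite ni.
  split=> [i B0|| i j nij B0i B0j].
  - have [E jC'] := joinedB'' i B0; rewrite E in B0 *.
    have [ii0|ni] := eqVneq i i0.
      rewrite /B' ii0 eqxx; split=> //; first exact: subset_trans sCU.
        by rewrite disjoint_sym disjoints_subset (subset_trans sC') // subsetDr.
      exact: unextendableS unX.
    have [-> Bi] := B'0 i B0 ni; have [cB sB dB uB] := B1 i Bi.
    by split=> //; [apply: disjointWr dB | apply: unextendableS uB].
  - by apply/hitsP => i /joinedB''[->].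
  have [Ei _] := joinedB'' i B0i; have [Ej _] := joinedB'' j B0j.
  rewrite Ei Ej in B0i B0j *.
  have [ii0|ni] := eqVneq i i0.
    have nj : j != i0 by rewrite -ii0 eq_sym.
    by have [-> Bj] := B'0 j B0j nj; rewrite /B' ii0 eqxx; apply: dX.
  have [-> Bi] := B'0 i B0i ni.
  have [jj0|nj] := eqVneq j i0.
    by rewrite /B' jj0 eqxx disjoint_sym joined_sym; apply: dX.
  by have [-> Bj] := B'0 j B0j nj; apply: B2.
(* [S] joins colour [i0]: no edge joins [A i0] to [X], which contains [S], and [B i0] is empty. *)
exists (fun i => if i == i0 then A i :|: S else A i).
have nj0 : ~~ joined (A i0) S.
  by have := nA i0; rewrite /B' eqxx; apply: contra; rewrite joined_sym; apply: joinedS.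
have sAC i : A i \subset C := subset_trans (sA i) (subsetDl _ _).
split=> [i|i|i|].
- by case: ifP => // _; rewrite subUset sAC (subset_trans sSX).
- by case: ifP => [/eqP->|//]; apply: stableU.
- case: ifP => [/eqP->|ni]; last by have := nA i; rewrite /B' ni.
  by apply/joinedP => -[u [v []]]; rewrite Bi0 inE.
rewrite (weight_split sX) (bigD1 i0) //= eqxx weightU; last first.
  rewrite disjoint_sym; apply: disjointWl sSX _.
  by rewrite disjoint_sym disjoints_subset (subset_trans (sA i0)) // subsetDr.
rewrite (eq_bigr (fun i => weight (A i))) => [|i /negPf-> //].
by rewrite (bigD1 i0) //= in wA; lra.
Qed.

(* The weighted form of the theorem of Reed and Seymour. *)
Theorem stable_sets_of_no_complete_model h (U : {set G}) : ~ complete_model h.+1 U ->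
  exists A : 'I_h -> {set G},
    [/\ forall i, A i \subset U, forall i, stable (A i)
      & (weight U <= 2 * \sum_i weight (A i))%R].
Proof.
move=> noK.
suff [A [sA stA _ wA]] : colorable (fun _ : 'I_h => set0) U by exists A.
apply: colorable_components => C cC sC _; apply: region_colorable (noK) cC sC _.
by split=> [i|| i j _]; rewrite ?eqxx //; apply/hitsP => i; rewrite eqxx.
Qed.

End Weighted.
End Connectivity.

(** * Vizing's theorem *)

Section Involutions.
Variables (T : finType) (s t : T -> T).
Hypotheses (sK : involutive s) (tK : involutive t).
Local Notation g := (t \o s).

Let g_inj : injective g := inj_comp (can_inj tK) (can_inj sK).

(* [s] conjugates [g] to its inverse. *)
Lemma reflect_iter n x : s x = x -> iter n g (s (iter n g x)) = x.
Proof.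
move=> sx; elim: n => [|n IH] //; rewrite iterSr -[RHS]IH; congr iter.
by rewrite iterS /= sK tK.
Qed.

(* A [g]-cycle through a fixed point of [s] is reflected by [s]. *)
Lemma three_fixed_points x y z :
  s x = x -> s y = y -> s z = z -> fconnect g x y -> fconnect g x z ->
  [|| x == y, x == z | y == z].
Proof.
move=> sx; have period y' : s y' = y' -> fconnect g x y' ->
    x = y' \/ (findex g x y').*2 = order g x.
  move=> sy xy; set n := findex g x y'; have nN : n < order g x := findex_max xy.
  have Ey : iter n g x = y' by rewrite iter_findex.
  (* Since [s] fixes [y'], the reflection gives [iter n g y' = x]. So the period divides [n.*2],
     which is less than twice the period. *)
  have n2 : iter n.*2 g x = x by rewrite -addnn iterD Ey -sy -{1}Ey reflect_iter.
  have [lt2|ge2] := ltnP n.*2 (order g x).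
    have := findex_iter lt2; rewrite n2 findex0 => /esym/eqP.
    by rewrite double_eq0 => /eqP n0; left; rewrite -Ey n0.
  right; apply/eqP; rewrite eqn_leq ge2 andbT -subn_eq0.
  have lt2 : n.*2 - order g x < order g x by lia.
  have := findex_iter lt2.
  have -> : iter (n.*2 - order g x) g x = x.
    by rewrite -[X in iter _ _ X](iter_order g_inj) -iterD subnK.
  by rewrite findex0 => <-.
move=> sy sz xy xz.
case: (period y sy xy) => [->|ny]; first by rewrite eqxx.
case: (period z sz xz) => [->|nz]; first by rewrite eqxx orbT.
(* Both points lie half a period away from [x]. *)
rewrite -(iter_findex xy) -(iter_findex xz).
have -> : findex g x y = findex g x z by apply: double_inj; rewrite ny nz.
by rewrite eqxx !orbT.
Qed.

(** By [reflect_iter], iterating [g] from [s w] leads back to [x]; and [t w] is the image of [s w]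
    under [g]. *)
Lemma fixed_point_orbit x w : s x = x -> fconnect g x w ->
  fconnect g x (s w) /\ fconnect g x (t w).
Proof.
move=> sx xw; have xsw : fconnect g x (s w).
  rewrite fconnect_sym // -(reflect_iter (findex g x w) sx) iter_findex //.
  exact: fconnect_iter.
by split=> //; apply: connect_trans xsw (connect1 _); rewrite /= sK.
Qed.

End Involutions.

Lemma sub_path_in_tail (T : eqType) (e e' : rel T) x p :
  (forall u v, u \in x :: p -> v \in p -> e u v -> e' u v) ->
  path e x p -> path e' x p.
Proof.
elim: p x => //= y p IH x sub /andP[xy yp].
rewrite sub ?mem_head //=; apply: IH yp => u v uyp vp; apply: sub.
  by rewrite inE uyp orbT.
by rewrite inE vp orbT.
Qed.

(** A path is cut at its first visit to [x]. *)
Lemma connect_last_step (T : finType) (e : rel T) u x : u != x -> connect e u x ->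
  exists2 v, e v x & connect [rel a b | [&& a != x, b != x & e a b]] u v.
Proof.
move=> ux /connectP[p]; elim: p u ux => [|v p IH] u ux /=.
  by move=> _ xu; rewrite xu eqxx in ux.
case/andP=> uv vp xl; have [Ev|vx] := eqVneq v x.
  by exists u => //; rewrite -Ev.
have [w wx vw] := IH v vx vp xl; exists w => //.
by apply: connect_trans vw; apply: connect1; rewrite /= ux vx.
Qed.

(** * Partial edge colourings, Kempe chains and fans *)

Section EdgeColouring.
Variables (G : sgraph) (n : nat).
Implicit Types (c : G -> G -> option 'I_n) (x y z u v : G) (a b : 'I_n).

Record proper_coloring c : Prop := ProperColoring {
  coloring_sym : forall x y, c x y = c y x;
  coloring_adj : forall x y a, c x y = Some a -> adj x y;
  coloring_inj : forall x y z a, c x y = Some a -> c x z = Some a -> y = z }.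

(** Pairs are ordered, so each coloured edge counts twice; the cardinality measures progress. *)
Definition colored c : {set G * G} := [set p | c p.1 p.2 != None].

Definition misses c x a := [forall y, c x y != Some a].

Lemma missesP c x a : reflect (forall y, c x y <> Some a) (misses c x a).
Proof. by apply: (iffP forallP) => H y; apply/eqP. Qed.

Lemma missing_color c x : proper_coloring c -> degree x < n ->
  exists a, misses c x a.
Proof.
move=> pc dx; apply/existsP; apply: contraLR dx => /existsPn used.
rewrite -leqNgt -[n]card_ord.
have y_ a : {y | c x y == Some a}.
  by apply/sigW; have := used a; rewrite negb_forall => /existsP[y /negPn]; exists y.
pose f a := sval (y_ a).
have fP a : c x (f a) = Some a by apply/eqP; apply: (svalP (y_ a)).
have finj : injective f by move=> a b ab; have := fP a; rewrite ab fP => -[].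
rewrite -(card_codom finj); apply: subset_leq_card; apply/subsetP => y /codomP[a ->].
exact: (coloring_adj pc (fP a)).
Qed.

Definition color_edge c x y (o : option 'I_n) : G -> G -> option 'I_n :=
  fun u v => if (u, v) \in [:: (x, y); (y, x)] then o else c u v.

Lemma color_edge_same c x y o : color_edge c x y o x y = o.
Proof. by rewrite /color_edge inE eqxx. Qed.

Lemma color_edge_other c x y o u v : u != x -> v != x ->
  color_edge c x y o u v = c u v.
Proof.
by move=> ux vx; rewrite /color_edge !inE !xpair_eqE (negPf ux) (negPf vx) andbF.
Qed.

Lemma color_edge_row c x y o v : x != y -> v != y -> color_edge c x y o x v = c x v.
Proof.
by move=> xy vy; rewrite /color_edge !inE !xpair_eqE (negPf xy) (negPf vy) andbF.
Qed.

Lemma color_edge_sym c x y o : (forall u v, c u v = c v u) ->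
  forall u v, color_edge c x y o u v = color_edge c x y o v u.
Proof.
move=> cs u v; rewrite /color_edge !inE !xpair_eqE cs.
by rewrite orbC (andbC (v == y)) (andbC (v == x)).
Qed.

Lemma color_edge_proper c x y a : proper_coloring c -> adj x y ->
  misses c x a -> misses c y a -> proper_coloring (color_edge c x y (Some a)).
Proof.
move=> [cs ca ci] xy /missesP mx /missesP my; split=> [|u v b|u v v' b].
- exact: color_edge_sym.
- rewrite /color_edge !inE !xpair_eqE; case: ifP => [|_ /ca//].
  by case/orP=> /andP[/eqP-> /eqP->] _; rewrite // adj_sym.
rewrite /color_edge !inE !xpair_eqE.
case: ifP => [/orP[]/andP[/eqP-> /eqP->] [<-]|_ cuv].
- rewrite eqxx /=; case: eqVneq => [-> //|_] /=.
  by case: ifP => [/andP[/eqP-> /eqP->] //|_ /mx].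
- rewrite eqxx /= orbC; case: eqVneq => [-> //|_] /=.
  by case: ifP => [/andP[/eqP-> /eqP->] //|_ /my].
case: ifP => [/orP[]/andP[/eqP Eu /eqP Ev] [Eb]|_ cuv']; last exact: ci cuv cuv'.
- by case: (mx v); rewrite -Eu Eb.
- by case: (my v); rewrite -Eu Eb.
Qed.

Lemma uncolor_edge_proper c x y : proper_coloring c ->
  proper_coloring (color_edge c x y None).
Proof.
move=> [cs ca ci]; split=> [|u v b|u v v' b].
- exact: color_edge_sym.
- by rewrite /color_edge; case: ifP => // _ /ca.
- by rewrite /color_edge; case: ifP => // _ cu; case: ifP => // _; apply: ci cu.
Qed.

Lemma colored_edge c x y a :
  colored (color_edge c x y (Some a)) = (x, y) |: ((y, x) |: colored c).
Proof.
apply/setP => -[u v]; rewrite !inE /= /color_edge !inE.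
by case: ((u, v) == (x, y)) => //=; case: ((u, v) == (y, x)).
Qed.

Lemma colored_uncolor c x y :
  colored (color_edge c x y None) = colored c :\ (x, y) :\ (y, x).
Proof.
apply/setP => -[u v]; rewrite !inE /= /color_edge !inE.
by case: ((u, v) == (x, y)); case: ((u, v) == (y, x)).
Qed.

Lemma extend_common c x y a : proper_coloring c -> adj x y -> c x y = None ->
  misses c x a -> misses c y a ->
  exists2 c', proper_coloring c' & #|colored c| < #|colored c'|.
Proof.
move=> pc xy cxy mx my; exists (color_edge c x y (Some a)).
  exact: color_edge_proper.
apply: proper_card; rewrite colored_edge properE; apply/andP; split.
  by rewrite setUA subsetUr.
by apply/subsetPn; exists (x, y); rewrite !inE ?eqxx //= cxy.
Qed.

Definition kempe c a b : rel G :=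
  [rel u v | (c u v == Some a) || (c u v == Some b)].

Definition transpose a b : 'I_n -> 'I_n :=
  fun i => if i == a then b else if i == b then a else i.

Lemma transposeK a b : involutive (transpose a b).
Proof.
move=> i; rewrite /transpose; case: (eqVneq i a) => [->|ia].
  by rewrite eqxx; case: eqP.
by case: (eqVneq i b) => [->|ib]; rewrite ?eqxx // (negPf ia) (negPf ib).
Qed.

Definition kempe_swap c a b y : G -> G -> option 'I_n :=
  fun u v => if connect (kempe c a b) y u then omap (transpose a b) (c u v) else c u v.

(** Edges coloured [a] or [b] have both ends in the component or both outside, and the transposition
    fixes all other colours, so the result stays symmetric. *)
Lemma kempe_swap_proper c a b y :
  proper_coloring c -> proper_coloring (kempe_swap c a b y).
Proof.
move=> [cs ca ci]; split.
- move=> u v; rewrite /kempe_swap (cs v u).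
  have [k|nk] := boolP (kempe c a b u v).
    have ks : kempe c a b v u by rewrite /kempe /= cs.
    suff -> : connect (kempe c a b) y u = connect (kempe c a b) y v by [].
    by apply/idP/idP => /connect_trans; apply; apply: connect1.
  suff -> : omap (transpose a b) (c u v) = c u v by rewrite !if_same.
  move: nk; rewrite /kempe /=; case: (c u v) => //= i; rewrite negb_or.
  by move=> /andP[ia ib]; rewrite /transpose !ifN.
- move=> u v i; rewrite /kempe_swap; case: ifP => _; last exact: ca.
  by case E: (c u v) => [j|//] _; apply: ca E.
- move=> u v w i; rewrite /kempe_swap; case: ifP => _; last exact: ci.
  case E: (c u v) => [j|//] [<-]; case E': (c u w) => [j'|//] [].
  by move/(can_inj (@transposeK a b)) => jj; rewrite jj in E'; apply: ci E E'.
Qed.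

(** Swapping on the component of [y] makes [a] missing at [y] and changes nothing at [x]. *)
Lemma kempe_extend c x y a b : proper_coloring c -> adj x y -> c x y = None ->
  misses c x a -> misses c y b -> ~~ connect (kempe c a b) y x ->
  exists2 c', proper_coloring c' & #|colored c| < #|colored c'|.
Proof.
move=> pc xy cxy mx my ncon; pose c1 := kempe_swap c a b y.
have dom1 : colored c1 = colored c.
  apply/setP => -[u v]; rewrite !inE /= /c1 /kempe_swap.
  by case: ifP => // _; case: (c u v).
have row1 v : c1 x v = c x v by rewrite /c1 /kempe_swap (negPf ncon).
rewrite -dom1; apply: (@extend_common c1 x y a) => //.
- exact: kempe_swap_proper.
- by rewrite row1.
- by apply/missesP => v; rewrite row1; apply/missesP.
apply/missesP => v; rewrite /c1 /kempe_swap connect0.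
case E: (c y v) => [i|//] [] Ei; case: (missesP _ _ _ my v); rewrite E.
congr Some; rewrite -[LHS](transposeK a b) Ei /transpose eqxx //.
Qed.

(** Uncolouring [xz] frees its colour [a] at [x], so that [xy] can receive it. *)
Lemma shift_once c x y z a : proper_coloring c -> adj x y -> x != y -> c x y = None ->
  c x z = Some a -> misses c y a ->
  exists c', [/\ proper_coloring c', #|colored c| <= #|colored c'|,
    forall u v, u != x -> v != x -> c' u v = c u v,
    c' x z = None /\ c' x y = Some a &
    forall v, v != y -> v != z -> c' x v = c x v].
Proof.
move=> pc xy nxy cxy cxz my; have zx : z != x.
  by apply: contraTneq (coloring_adj pc cxz) => ->; rewrite adj_irrefl.
have nyz : y != z by apply: contra_eq_neq cxy => ->; rewrite cxz.
have nxz : x != z by rewrite eq_sym.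
have nyx : y != x by rewrite eq_sym.
pose c1 := color_edge c x z None.
have pc1 : proper_coloring c1 := uncolor_edge_proper x z pc.
exists (color_edge c1 x y (Some a)); split.
- apply: color_edge_proper => //; apply/missesP => v; rewrite /c1.
    have [->|vz] := eqVneq v z; first by rewrite color_edge_same.
    rewrite color_edge_row // => cxv; case/eqP: vz.
    exact: (coloring_inj pc cxv cxz).
  rewrite /color_edge; case: ifP => // _; exact/missesP.
- rewrite colored_edge colored_uncolor !cardsU1 !inE !xpair_eqE !eqxx /=.
  rewrite cxy (coloring_sym pc y x) cxy !andbF /= (negPf nxy) (negPf nyx) /=.
  rewrite (cardsD1 (x, z) (colored c)) (cardsD1 (z, x) (colored c :\ _)).
  by rewrite !inE xpair_eqE (negPf zx) (coloring_sym pc z x) /= cxz !add1n.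
- by move=> u v ux vx; rewrite color_edge_other // /c1 color_edge_other.
- by rewrite color_edge_same color_edge_row 1?eq_sym // /c1 color_edge_same.
- by move=> v vy vz; rewrite color_edge_row // /c1 color_edge_row.
Qed.

(** The step of a Vizing fan at [x]: the colour of [xv] may be moved to [xu]. *)
Definition fan_step c x : rel G :=
  [rel u v | [exists a, (c x v == Some a) && misses c u a]].

(* The colours of the fan edges [x z], for [z] in [p], move one step towards [y]. *)
Lemma shift_fan c x y p : proper_coloring c -> adj x y -> c x y = None ->
  path (fan_step c x) y p -> uniq (y :: p) ->
  exists c', [/\ proper_coloring c' /\ #|colored c| <= #|colored c'|,
    forall u v, u != x -> v != x -> c' u v = c u v,
    c' x (last y p) = None,
    (forall a, misses c x a -> misses c' x a) /\
    (forall a, misses c (last y p) a -> misses c' (last y p) a) &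
    (forall v, v \notin y :: p -> c' x v = c x v) /\
    (forall p1 z p2, p = p1 ++ z :: p2 -> c' x (last y p1) = c x z)].
Proof.
elim: p c y => [|z p IH] c y pc xy cxy /=.
  move=> _ _; exists c; split=> //; split=> // p1 z p2.
  by case: p1.
case/andP=> /existsP[a /andP[/eqP cxz my]] pp /andP[nyzp /andP[nzp up]].
have nxy : x != y by apply: contraTneq xy => ->; rewrite adj_irrefl.
have [c1 [pc1 le1 off1 [c1z c1y] row1]] := shift_once pc xy nxy cxy cxz my.
have xz : adj x z := coloring_adj pc cxz.
have nzx : z != x by apply: contraTneq xz => ->; rewrite adj_irrefl.
have nyz : y != z by apply: contraNneq nyzp => ->; rewrite mem_head.
have yp : y \notin p by apply: contra nyzp; rewrite inE orbC => ->.
have memp v : v \in p -> v != y /\ v != z.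
  by move=> vp; split; [apply: contraNneq yp => <- | apply: contraNneq nzp => <-].
have missx b : misses c x b -> misses c1 x b.
  move=> /missesP m; apply/missesP => v.
  have [->|vy] := eqVneq v y; first by rewrite c1y -cxz; apply: m.
  have [->|vz] := eqVneq v z; first by rewrite c1z.
  by rewrite row1.
have miss1 u b : u != y -> misses c u b -> misses c1 u b.
  move=> uy; have [->|ux] := eqVneq u x; first exact: missx.
  move=> /missesP m; apply/missesP => v.
  have [->|vx] := eqVneq v x; last by rewrite off1.
  rewrite (coloring_sym pc1); have [->|uz] := eqVneq u z; first by rewrite c1z.
  by rewrite row1 // (coloring_sym pc).
have pp1 : path (fan_step c1 x) z p.
  apply: sub_path_in_tail pp => u v uzp vp /existsP[b /andP[cxv mu]].
  have [vy vz] := memp v vp; apply/existsP; exists b; rewrite row1 // cxv miss1 //.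
  by apply: contraNneq nyzp => <-.
have zpu : uniq (z :: p) by rewrite /= nzp.
have [c' [[pc' le'] off' last' [mx' ml'] [row' tail']]] := IH c1 z pc1 xz c1z pp1 zpu.
exists c'; split=> //.
- by split=> //; apply: leq_trans le1 le'.
- by move=> u v ux vx; rewrite off' ?off1.
- split=> b; first by move/missx/mx'.
  by move=> m; apply/ml'/miss1 => //; apply: contraNneq nyzp => <-; apply: mem_last.
split=> [v|[|z' p1] z0 p2].
- rewrite inE negb_or => /andP[vy vzp]; rewrite row' // row1 //.
  by apply: contraNneq vzp => ->; rewrite mem_head.
- by case=> <- _ /=; rewrite row' // c1y cxz.
case=> <- Ep /=; rewrite (tail' p1 z0 p2 Ep); have z0p : z0 \in p.
  by rewrite Ep mem_cat mem_head orbT.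
by have [? ?] := memp z0 z0p; rewrite row1.
Qed.

Hypothesis n_gt : forall x, degree x < n.

(** The fan grows as long as a colour missing at its last vertex leads from [x] outside the fan; [k]
    bounds the remaining steps. *)
Lemma maximal_fan c x y : proper_coloring c -> exists p b,
  [/\ path (fan_step c x) y p, uniq (y :: p), misses c (last y p) b
    & forall z, c x z = Some b -> z \in y :: p].
Proof.
move=> pc; suff: forall k p, #|G| <= size p + k -> path (fan_step c x) y p ->
    uniq (y :: p) -> exists p b, [/\ path (fan_step c x) y p, uniq (y :: p),
      misses c (last y p) b & forall z, c x z = Some b -> z \in y :: p].
  by move/(_ #|G| [::]); apply.
elim=> [|k IH] p sp pp up.
  have := leq_trans (max_card (mem (y :: p))) sp.
  by rewrite (card_uniqP up) addn0 ltnn.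
have [b mb] := missing_color pc (n_gt (last y p)).
have [/existsP[z /andP[/eqP cz zp]]|/existsPn nz] :=
  boolP [exists z, (c x z == Some b) && (z \notin y :: p)].
  apply: (IH (rcons p z)).
  - by rewrite size_rcons; lia.
  - by rewrite rcons_path pp; apply/existsP; exists b; rewrite cz eqxx.
  by rewrite -rcons_cons rcons_uniq zp.
exists p, b; split=> // z cz; apply: contraT => zp.
by have := nz z; rewrite cz eqxx zp.
Qed.

(** The partner of [u] along colour [a] in [G - x]; vertices without partner are fixed, which makes
    this an involution. *)
Definition mate c x a u : G :=
  odflt u [pick v | [&& u != x, v != x & c u v == Some a]].

Lemma mateP c x a u v : proper_coloring c -> u != x -> v != x ->
  c u v = Some a -> mate c x a u = v.
Proof.
move=> pc ux vx cuv; rewrite /mate; case: pickP => [w|/(_ v)] /=.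
  by case/and3P=> _ _ /eqP cuw; apply: (coloring_inj pc cuw cuv).
by rewrite ux vx cuv eqxx.
Qed.

Lemma mateK c x a : proper_coloring c -> involutive (mate c x a).
Proof.
move=> pc u; rewrite {2}/mate; case: pickP => [v|none] /=.
  by case/and3P=> ux vx /eqP cuv; apply: mateP; rewrite // (coloring_sym pc).
by rewrite /mate; case: pickP => [v|//]; rewrite none.
Qed.

Lemma mate_missing c x a u : (forall v, v != x -> c u v <> Some a) ->
  mate c x a u = u.
Proof.
move=> m; rewrite /mate; case: pickP => [v|//].
by case/and3P=> _ vx /eqP cuv; case: (m v vx).
Qed.

(* In [G - x] the colours [a] and [b] form paths and cycles, and a vertex missed
   by [b] is an end of its path. *)
Lemma kempe_ends c x a b y z t : proper_coloring c ->
  let e := [rel u v | [&& u != x, v != x & kempe c a b u v]] in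
  (forall v, v != x -> c y v <> Some b) ->
  (forall v, v != x -> c z v <> Some b) ->
  (forall v, v != x -> c t v <> Some b) ->
  connect e y z -> connect e y t -> [|| y == z, y == t | z == t].
Proof.
move=> pc e /mate_missing my /mate_missing mz /mate_missing mt yz yt.
have bK := mateK x b pc; have aK := mateK x a pc.
pose g := mate c x a \o mate c x b.
(* The orbit of the fixed point [y] is closed under both mates, so it contains the whole component
   of [y]. *)
suff con v : connect e y v -> fconnect g y v.
  by apply: (three_fixed_points bK aK) => //; apply: con.
case/connectP=> p; elim/last_ind: p v => [|p w IH] v.
  by move=> _ ->; apply: connect0.
rewrite rcons_path last_rcons => /andP[yp /and3P[lx wx cw]] ->.
have [ob oa] := fixed_point_orbit bK aK my (IH _ yp erefl).
by case/orP: cw => /eqP cw; rewrite -(mateP pc lx wx cw).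
Qed.

(** Let [a] be missing at [x] and [b] at the last vertex [yk] of a maximal fan. If [b] is missing at
    [x], shift the whole fan. Otherwise [b] colours some fan edge [xz], and the predecessor [y1] of
    [z] misses [b] too. Shift up to [yk] (giving [c1]) or up to [y1] (giving [c2]), then try a Kempe
    swap. If both swaps fail, [y1], [z] and [yk] lie on one chain of [G - x] and all miss [b] there,
    which is too many ends. *)
Lemma vizing_extend c x y : proper_coloring c -> adj x y -> c x y = None ->
  exists2 c', proper_coloring c' & #|colored c| < #|colored c'|.
Proof.
move=> pc xy cxy.
have [a ma] := missing_color pc (n_gt x).
have [p [b [pp up mb full]]] := maximal_fan x y pc.
have adj_fan q : path (fan_step c x) y q -> adj x (last y q).
  case/lastP: q => [//|q z]; rewrite rcons_path last_rcons.
  by case/andP=> _ /existsP[i /andP[/eqP cz _]]; apply: (coloring_adj pc cz).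
have [c1 [[pc1 le1] off1 lst1 [mx1 ml1] [row1 tail1]]] := shift_fan pc xy cxy pp up.
have better c2 : (exists2 c', proper_coloring c' & #|colored c2| < #|colored c'|) ->
    #|colored c| <= #|colored c2| ->
    exists2 c', proper_coloring c' & #|colored c| < #|colored c'|.
  by case=> c' pc' lt le; exists c' => //; apply: leq_ltn_trans lt.
have [mbx|/forallPn[z /negPn/eqP cxz]] := boolP (misses c x b).
  apply: (better c1) => //; apply: extend_common pc1 (adj_fan p pp) lst1 _ (ml1 _ mb).
  exact: mx1.
have zp : z \in p.
  by move: (full z cxz); rewrite inE => /predU1P[zy|//]; rewrite zy cxy in cxz.
case/splitPr: {2}p / zp (erefl p) => p1 p2 Ep.
have pp' : path (fan_step c x) y (p1 ++ z :: p2) by rewrite -Ep.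
have up' : uniq (y :: p1 ++ z :: p2) by rewrite -Ep.
move: pp'; rewrite cat_path => /andP[pp1 /= /andP[/existsP[b' /andP[cz mb1]] _]].
have Eb : b' = b by move: cz; rewrite cxz => /eqP[].
rewrite {b' cz}Eb in mb1.
have nyz : z \notin y :: p1.
  apply: contraL up' => zyp; rewrite -cat_cons cat_uniq /= zyp.
  by rewrite andbF.
have up1 : uniq (y :: p1) by move: up'; rewrite -cat_cons cat_uniq => /andP[].
have [c2 [[pc2 le2] off2 lst2 [mx2 ml2] [row2 tail2]]] := shift_fan pc xy cxy pp1 up1.
set y1 := last y p1 in mb1 lst2 ml2 *; set yk := last y p in mb lst1 ml1 *.
have [con1|ncon1] := boolP (connect (kempe c1 a b) yk x); last first.
  apply: (better c1) => //; apply: kempe_extend pc1 (adj_fan p pp) lst1 _ (ml1 _ mb) ncon1.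
  exact: mx1.
have [con2|ncon2] := boolP (connect (kempe c2 a b) y1 x); last first.
  apply: (better c2) => //; apply: kempe_extend pc2 (adj_fan p1 pp1) lst2 _ (ml2 _ mb1) ncon2.
  exact: mx2.
have neqx v : adj x v -> v != x by apply: contraTneq => ->; rewrite adj_irrefl.
have ykx : yk != x := neqx _ (adj_fan p pp).
have y1x : y1 != x := neqx _ (adj_fan p1 pp1).
pose e := [rel u v | [&& u != x, v != x & kempe c a b u v]].
have off_e c' : (forall u v, u != x -> v != x -> c' u v = c u v) ->
    subrel (connect [rel u v | [&& u != x, v != x & kempe c' a b u v]]) (connect e).
  move=> off; apply: connect_sub => u v /and3P[ux vx k]; apply: connect1.
  by move: k; rewrite /e /kempe /= off ?ux ?vx.
(* As [a] is missing at [x], a chain enters [x] by its only edge coloured [b]: from [y1] in [c1],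
   from [z] in [c2]. *)
have last_b c' v w : proper_coloring c' -> misses c' x a -> kempe c' a b v x ->
    c' x w = Some b -> v = w.
  move=> pc' /missesP m k cw; apply: (coloring_inj pc' (x := x)) cw.
  by move: k; rewrite /kempe /= (coloring_sym pc') => /orP[/eqP/m|/eqP].
have [v1 k1 yk1] := connect_last_step ykx con1.
have Ev1 : v1 = y1.
  by apply: (last_b c1) => //; [exact: mx1 | rewrite (tail1 p1 z p2)].
have [v2 k2 y12] := connect_last_step y1x con2.
have Ev2 : v2 = z by apply: (last_b c2) => //; [exact: mx2 | rewrite row2].
rewrite {v1 k1}Ev1 in yk1; rewrite {v2 k2}Ev2 in y12.
have y1k : connect e y1 yk.
  have e_sym : symmetric e by move=> u v; rewrite /e /kempe /= (coloring_sym pc) andbCA.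
  by rewrite sym_connect_sym //; apply: off_e yk1.
have mz v : v != x -> c z v <> Some b.
  move=> vx czv; case/eqP: vx; apply: (coloring_inj pc czv).
  by rewrite (coloring_sym pc).
have := kempe_ends pc (fun v _ => missesP _ _ _ mb1 v) mz
  (fun v _ => missesP _ _ _ mb v) (off_e _ off2 _ _ y12) y1k.
have y1yp : y1 \in y :: p1 by apply: mem_last.
have ykz : yk \in z :: p2 by rewrite /yk Ep last_cat /= mem_last.
(* The first two equalities repeat a fan vertex; the third fails because [xz] has colour [b],
   missing at [yk]. *)
case/or3P=> /eqP E.
- by rewrite E (negPf nyz) in y1yp.
- move: up'; rewrite -cat_cons cat_uniq => /and3P[_ /hasPn/(_ yk ykz)].
  by rewrite -E /= y1yp.
- by case: (missesP _ _ _ mb x); rewrite -E (coloring_sym pc).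
Qed.

Theorem vizing : exists2 c, proper_coloring c & forall x y, adj x y -> c x y != None.
Proof.
suff: forall k c, proper_coloring c -> #|{: G * G}| <= #|colored c| + k ->
    exists2 c, proper_coloring c & forall x y, adj x y -> c x y != None.
  by move/(_ #|{: G * G}| (fun _ _ => None)); apply; rewrite ?leq_addl.
elim=> [|k IH] c pc le;
  (have [/forallP full|/forallPn[x /forallPn[y]]] :=
     boolP [forall x, forall y, adj x y ==> (c x y != None)];
   first by exists c => // x y; apply/implyP; move/forallP: (full x); apply);
  rewrite negb_imply => /andP[xy /negPn/eqP cxy];
  have [c' pc' lt] := vizing_extend pc xy cxy.
  by have := leq_trans (leq_trans lt (max_card _)) le; rewrite addn0 ltnn.
by apply: (IH c' pc'); apply: leq_trans le _; rewrite addnS -addSn leq_add2r.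
Qed.

End EdgeColouring.

(** * Induced matchings in the colour classes *)

Section ColorClasses.
Variables (G : sgraph) (n : nat) (c : G -> G -> option 'I_n).
Hypotheses (c_proper : proper_coloring c).
Hypothesis c_total : forall x y, adj x y -> c x y != None.
Implicit Types (E F : edge G).

Local Notation LG2 := (square (line_graph G)).

Lemma edgeP E : exists x y, adj x y /\ val E = [set x; y].
Proof.
by have := valP E; rewrite inE => /existsP[x /existsP[y /andP[xy /eqP]]]; exists x, y.
Qed.

Definition color_class (a : 'I_n) : {set LG2} :=
  [set E : edge G | [exists x, exists y, (val E == [set x; y]) && (c x y == Some a)]].

Lemma color_class_cover E : exists a, E \in color_class a.
Proof.
have [x [y [xy Exy]]] := edgeP E.
case Ec: (c x y) (c_total xy) => [a|//] _; exists a; rewrite inE.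
by apply/existsP; exists x; apply/existsP; exists y; rewrite Exy Ec !eqxx.
Qed.

Lemma color_class_matching a E F x : E \in color_class a -> F \in color_class a ->
  x \in val E -> x \in val F -> E = F.
Proof.
have other D : D \in color_class a -> x \in val D ->
    exists2 y, val D = [set x; y] & c x y = Some a.
  rewrite inE => /existsP[u /existsP[v /andP[/eqP-> /eqP cuv]]].
  rewrite !inE => /orP[]/eqP->; first by exists v.
  by exists u; [rewrite setUC | rewrite (coloring_sym c_proper)].
move=> Ea Fa xE xF; apply: val_inj.
have [y -> cy] := other E Ea xE; have [z -> cz] := other F Fa xF.
by rewrite (coloring_inj c_proper cy cz).
Qed.

Definition endpoints (P : {set LG2}) : {set G} :=
  [set x | [exists E : edge G, (E \in P) && (x \in val E)]].

Lemma endpointsP (P : {set LG2}) x : reflect (exists2 E : edge G, E \in P & x \in val E)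
  (x \in endpoints P).
Proof.
rewrite inE; apply: (iffP existsP) => -[E]; first by case/andP; exists E.
by move=> EP xE; exists E; rewrite EP.
Qed.

Lemma endpoints_connected (P : {set LG2}) : connected_set P ->
  connected_set (endpoints P).
Proof.
case/connected_setP=> /set0Pn[E0 E0P] cP; apply/connected_setP; split.
  have [x [y [_ Exy]]] := edgeP E0; apply/set0Pn; exists x.
  by apply/endpointsP; exists E0; rewrite // Exy set21.
have inside E x y : E \in P -> x \in val E -> y \in val E ->
    connect (induced (endpoints P)) x y.
  move=> EP xE yE; have [->|nxy] := eqVneq x y; first exact: connect0.
  apply: connect1; apply/and3P; split; try by apply/endpointsP; exists E.
  have [u [v [uv Euv]]] := edgeP E; move: xE yE nxy; rewrite Euv !inE.
  by case/orP=> /eqP-> /orP[]/eqP->; rewrite ?eqxx // adj_sym.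
move=> x y /endpointsP[E EP xE] /endpointsP[F FP yF].
have /connectP[p] := cP E F EP FP.
elim: p E EP x xE => [|D p IH] E EP x xE /=; first by move=> _ EF; subst F; apply: inside yF.
case/andP=> /and3P[_ DP /square_line_graphP[_ ED]] Dp lst.
case: ED => [[z [zE zD]]|[u [v [uE vD uv]]]].
  by apply: connect_trans (inside E _ _ EP xE zE) (IH D DP z zD Dp lst).
apply: connect_trans (inside E _ _ EP xE uE) _.
apply: connect_trans (IH D DP v vD Dp lst); apply: connect1.
by apply/and3P; split=> //; apply/endpointsP; [exists E | exists D].
Qed.

(* Contracting the edges of a matching maps the square of the line graph,
   restricted to this matching, to a minor of [G]. *)
Lemma minor_of_color_class_model k a :
  complete_model k (color_class a) -> minor (complete k) G.
Proof.
case=> phi [cphi sphi dphi jphi]; exists (fun i => endpoints (phi i)); split.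
- by move=> i; apply: endpoints_connected.
- move=> i j nij; apply/pred0Pn => -[x /andP[/endpointsP[E Ei xE] /endpointsP[F Fj xF]]].
  have EF := color_class_matching (subsetP (sphi i) _ Ei) (subsetP (sphi j) _ Fj) xE xF.
  by have := disjointFr (dphi i j nij) Ei; rewrite EF Fj.
move=> i j nij; have /joinedP[E [F [Ei Fj /square_line_graphP[nEF]]]] := jphi i j nij.
case=> [[x [xE xF]]|[x [y [xE yF xy]]]].
  by case: nEF; apply: color_class_matching xE xF;
    [apply: (subsetP (sphi i)) Ei | apply: (subsetP (sphi j)) Fj].
by exists x, y; split=> //; apply/endpointsP; [exists E | exists F].
Qed.

End ColorClasses.

(** A stable set [S] of maximum weight is at least as heavy as each of the [h] sets obtained in each
    of the [max_degree G + 1] colour classes. *)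
Lemma heavy_induced_matching (R : realDomainType) (h : nat) (G : sgraph)
    (w : square (line_graph G) -> R) :
  ~ minor (complete h.+1) G -> (forall E, (0 <= w E)%R) ->
  exists2 S, stable S &
    (\sum_E w E <= 2 * h%:R * ((max_degree G)%:R + 1) * \sum_(E in S) w E)%R.
Proof.
move=> noK w0.
have deg (x : G) : degree x < (max_degree G).+1 by rewrite ltnS; apply: leq_bigmax.
have [c pc tc] := vizing deg.
have [A AP] := fin_all_exists (fun a => stable_sets_of_no_complete_model w
  (fun K => noK (minor_of_color_class_model pc (a := a) K))).
have s0 := stable_set0 (square (line_graph G)).
case: (@arg_maxP _ _ _ set0 (@stable _) (weight w) s0) => S sS Smax.
exists S => //.
apply: le_trans (_ : \sum_a weight w (color_class c a) <= _)%R.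
  under [leRHS]eq_bigr do rewrite /weight big_mkcond.
  rewrite exchange_big /=; apply: ler_sum => E _.
  have [a Ea] := color_class_cover tc E.
  rewrite (bigD1 a) //= Ea lerDl sumr_ge0 // => b _; by case: ifP.
apply: le_trans (_ : \sum_(a < (max_degree G).+1) 2 * h%:R * weight w S <= _)%R.
  apply: ler_sum => a _; have [_ stA wA] := AP a; apply: le_trans wA _.
  rewrite -mulrA ler_wpM2l ?ler0n //.
  apply: le_trans (ler_sum _ (fun i _ => Smax _ (stA i))) _.
  by rewrite sumr_const card_ord mulr_natl.
by rewrite sumr_const card_ord -[leLHS]mulr_natr -[(max_degree G).+1]addn1 natrD mulrAC.
Qed.

(** * Duality *)

Local Open Scope ring_scope.

Section Duality.
Variables (R : realType) (F : sgraph).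
Implicit Types (p : {set F} -> R) (S : {set F}).

(** For a distribution [p], the probability that a random stable set contains [v]. *)
Definition coverage p (v : F) : R :=
  \sum_(S : {set F} | stable S && (v \in S)) p S.

Definition deficit (a : R) p (v : F) : R := Num.max 0 (a - coverage p v).

Definition distribution p : Prop :=
  (forall S, 0 <= p S) /\ total_weight p = 1.

Lemma coverage_ge0 p v : distribution p -> 0 <= coverage p v.
Proof. by case=> p0 _; apply: sumr_ge0. Qed.

Lemma coverage_le1 p v : distribution p -> coverage p v <= 1.
Proof.
case=> p0 <-; rewrite /total_weight (bigID (fun S : {set F} => v \in S)) /=.
by rewrite lerDl sumr_ge0.
Qed.

Definition mix (g : R) p S0 : {set F} -> R :=
  fun S => (1 - g) * p S + g * (S == S0)%:R.

Lemma sum_mix (P : pred {set F}) g p S0 :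
  \sum_(S | P S) mix g p S0 S = (1 - g) * (\sum_(S | P S) p S) + g * (P S0)%:R.
Proof.
rewrite big_split /= -!mulr_sumr; congr (_ + _ * _).
case: (boolP (P S0)) => PS0.
  by rewrite (bigD1 S0) //= eqxx big1 ?addr0 // => S /andP[_ /negPf->].
by rewrite big1 // => S PS; case: eqP PS PS0 => [->->|].
Qed.

Lemma distribution_mix g p S0 :
  0 <= g <= 1 -> stable S0 -> distribution p -> distribution (mix g p S0).
Proof.
move=> /andP[g0 g1] sS0 [p0 p1]; split=> [S|].
  by rewrite addr_ge0 ?mulr_ge0 ?subr_ge0 ?ler0n.
by rewrite /total_weight sum_mix -/(total_weight p) p1 sS0 !mulr1 subrK.
Qed.

Lemma coverage_mix g p S0 v : stable S0 ->
  coverage (mix g p S0) v = (1 - g) * coverage p v + g * (v \in S0)%:R.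
Proof. by move=> sS0; rewrite /coverage sum_mix sS0. Qed.

(** Mixing replaces the slack [q = a - c] by [q - d] with [d = g * (s - c)]. Positive parts satisfy
    the expansion of the square as an upper bound, and [d ^+ 2 <= g ^+ 2] as [s] and [c] lie in
    [[0, 1]]. *)
Lemma sqr_deficit_mix a g p S0 v : 0 <= g -> stable S0 -> distribution p ->
  deficit a (mix g p S0) v ^+ 2 <=
    deficit a p v ^+ 2
    - 2 * g * (deficit a p v * ((v \in S0)%:R - coverage p v)) + g ^+ 2.
Proof.
move=> g0 sS0 dp; rewrite /deficit coverage_mix //.
have c0 := coverage_ge0 v dp; have c1 := coverage_le1 v dp.
set c := coverage p v in c0 c1 *; set s : R := (v \in S0)%:R.
have [s0 s1] : 0 <= s /\ s <= 1 by rewrite /s ler0n lern1 leq_b1.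
have dd : (g * (s - c)) ^+ 2 <= g ^+ 2.
  rewrite exprMn ler_piMr ?sqr_ge0 // -subr_ge0.
  have -> : 1 - (s - c) ^+ 2 = (1 - s + c) * (1 + s - c) by ring.
  by rewrite mulr_ge0 //; lra.
have E : a - ((1 - g) * c + g * s) = (a - c) - g * (s - c) by ring.
rewrite E; move: dd; set q := a - c; set d := g * (s - c) => dd.
have -> : forall z : R, 2 * g * (z * (s - c)) = 2 * (z * d).
  by move=> z; rewrite /d; ring.
case: (leP 0 q) => q0; case: (leP 0 (q - d)) => qd; clearbody d q.
- by have -> : (q - d) ^+ 2 = q ^+ 2 - 2 * (q * d) + d ^+ 2; [ring | lra].
- by rewrite expr0n /=; have := sqr_ge0 (q - d); nra.
- have : 0 <= (- q) * (q - 2 * d) by nra.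
  by rewrite expr0n /=; nra.
- by rewrite expr0n /= mul0r; nra.
Qed.

Hypothesis (N : R) (N0 : 0 < N).
Hypothesis heavy_stable : forall w : F -> R, (forall v, 0 <= w v) ->
  exists2 S, stable S & \sum_v w v <= N * \sum_(v in S) w v.

(* Frank-Wolfe iteration with step size [1/(t+2)]: the stable set found for the
   current deficits is mixed into the distribution. *)
Lemma small_deficits t : exists2 p, distribution p &
  \sum_v deficit N^-1 p v ^+ 2 <= #|F|%:R * (1 + N^-1 ^+ 2) / t.+1%:R.
Proof.
set a := N^-1; have a0 : 0 < a by rewrite invr_gt0.
set K := #|F|%:R * (1 + _).
have KF : #|F|%:R <= K.
  by rewrite /K ler_peMr ?ler0n // lerDl sqr_ge0.
elim: t => [|t [p dp IH]].
  have dp : distribution (fun S => (S == set0)%:R).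
    split=> [S|]; first exact: ler0n.
    rewrite /total_weight (bigD1 set0) ?stable_set0 //= eqxx big1 ?addr0 //.
    by move=> S /andP[_ /negPf->].
  exists (fun S => (S == set0)%:R) => //.
  rewrite divr1 /K mulrDr mulr1 mulr_natl.
  rewrite -[leLHS]add0r lerD ?ler0n // -sumr_const ler_sum // => v _.
  have c0 := coverage_ge0 v dp; rewrite /deficit -/a.
  by case: (leP 0 (a - coverage _ v)) => ?; nra.
have [S sS hS] := @heavy_stable (deficit a p) (fun v => ltac:(by rewrite le_max lexx)).
pose g : R := t.+2%:R^-1.
have tp : 0 < t.+1%:R :> R by rewrite ltr0n.
have E2 : t.+2%:R = t.+1%:R + 1 :> R by rewrite -[t.+2]addn1 natrD.
have g0 : 0 < g by rewrite invr_gt0 ltr0n.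
have g1 : g <= 1 by rewrite invf_le1 ?ltr0n ?ler1n.
exists (mix g p S); first by apply: distribution_mix; rewrite // g1 ltW.
(* For [g = 1/(t+2)] the middle term equals [K/(t+2)] times [1 - 1/((t+1)(t+2))]. *)
apply: le_trans (_ : (1 - 2 * g) * (K / t.+1%:R) + K * g ^+ 2 <= _); last first.
  rewrite /g E2; have := ler0n R #|F|; set x : R := t.+1%:R in tp *.
  move=> F0; have K0 : 0 <= K by lra.
  have -> : (1 - 2 * (x + 1)^-1) * (K / x) + K * (x + 1)^-1 ^+ 2 =
     K / (x + 1) * (1 - (x * (x + 1))^-1) by field; apply/andP; split; lra.
  by rewrite ler_piMr ?divr_ge0 //; [lra | rewrite gerBl invr_ge0; nra].
have t1 : 1 <= t.+1%:R :> R by rewrite ler1n.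
have g2 : 0 <= 1 - 2 * g.
  by rewrite subr_ge0 /g ler_pdivrMr ?ltr0n // E2; lra.
apply: le_trans (lerD (ler_wpM2l g2 IH) (ler_wpM2r (sqr_ge0 g) KF)).
apply: le_trans (ler_sum _ (fun v _ => @sqr_deficit_mix a g p S v (ltW g0) sS dp)) _.
rewrite big_split /= sumr_const -[_ *+ #|F|]mulr_natl lerD2r.
rewrite sumrB -mulr_sumr mulrBl mul1r lerD2l lerN2 ler_wpM2l //; first lra.
(* Where the deficit is nonzero it equals [a] minus the coverage, so the claim becomes [a] times the
   total deficit being at most the deficit on [S]: this is the choice of [S], with [a = N^-1]. *)
under [leRHS]eq_bigr do rewrite mulrBr.
rewrite sumrB lerBrDr.
have -> : \sum_v deficit a p v * (v \in S)%:R = \sum_(v in S) deficit a p v.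
  rewrite [RHS]big_mkcond; apply: eq_bigr => v _.
  by case: (v \in S); rewrite (mulr1, mulr0).
have -> : \sum_v deficit a p v ^+ 2 + \sum_v deficit a p v * coverage p v =
   a * \sum_v deficit a p v.
  rewrite mulr_sumr -big_split /=; apply: eq_bigr => v _.
  by rewrite /deficit; case: leP => ?; ring.
by rewrite ler_pdivrMl.
Qed.

(** For each [e > 0], deficits below [N^-1 - (N + e)^-1] mean coverage above [(N + e)^-1], so [p]
    scaled by [N + e] is a fractional colouring. *)
Lemma fractional_chromatic_number_le_dual_pos :
  fractional_chromatic_number R F <= N.
Proof.
apply/ler_addgt0Pr => e e0.
have Ne0 : 0 < N + e by rewrite addr_gt0.
pose d := N^-1 - (N + e)^-1.
have d0 : 0 < d by rewrite subr_gt0 ltf_pV2 ?posrE // ltrDl.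
set K := #|F|%:R * (1 + N^-1 ^+ 2).
have K0 : 0 <= K by rewrite mulr_ge0 ?ler0n // addr_ge0 ?sqr_ge0.
have [t ht] : exists t, K / t.+1%:R < d ^+ 2.
  exists (Num.truncn (K / d ^+ 2)); rewrite ltr_pdivrMr ?ltr0n //.
  by rewrite mulrC -ltr_pdivrMr ?exprn_gt0 // truncnS_gt.
have [p [p0 p1] hp] := small_deficits t.
have tw : total_weight (fun S => (N + e) * p S) = N + e.
  by rewrite /total_weight -mulr_sumr -/(total_weight p) p1 mulr1.
rewrite -[leRHS]tw; apply: fractional_chromatic_number_le; split=> [S _|v].
  by rewrite mulr_ge0 // ltW.
rewrite -mulr_sumr -ler_pdivrMl // mulr1 -/(coverage p v).
have : deficit N^-1 p v ^+ 2 < d ^+ 2.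
  apply: le_lt_trans ht; apply: le_trans hp.
  by rewrite (bigD1 v) //= lerDl sumr_ge0 // => *; rewrite sqr_ge0.
have q0 : 0 <= deficit N^-1 p v by rewrite le_max lexx.
rewrite ltr_pXn2r ?nnegrE ?(ltW d0) // /deficit gt_max => /andP[_].
by rewrite /d; lra.
Qed.
End Duality.

Lemma fractional_chromatic_number_le_dual (R : realType) (F : sgraph) (N : R) :
  0 <= N ->
  (forall w : F -> R, (forall v, 0 <= w v) ->
     exists2 S, stable S & \sum_v w v <= N * \sum_(v in S) w v) ->
  fractional_chromatic_number R F <= N.
Proof.
rewrite le_eqVlt => /predU1P[<-|N0] H; last first.
  exact: fractional_chromatic_number_le_dual_pos.
(* For [N = 0], unit weights show that [F] has no vertex, and the zero function is a colouring. *)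
have F0 : F -> False.
  move=> v; have [|S _] := H (fun=> 1); first by move=> _; exact: ler01.
  by rewrite mul0r sumr_const lern0 -leqn0 leqNgt; apply/negP/negPn/card_gt0P; exists v.
rewrite -[leRHS](_ : total_weight (fun _ : {set F} => 0 : R) = 0).
  by apply: fractional_chromatic_number_le; split=> // v; case: (F0 v).
by rewrite /total_weight big1.
Qed.

Theorem theorem1p10 (R : realType) (k Delta : nat) (G : sgraph)
    (hminor : minor_free (complete k) G) (hDelta : max_degree G = Delta) :
  fractional_strong_chromatic_index R G <= 2 * (k%:R - 1) * (Delta%:R + 1).
Proof.
(* For [k = 0] the hypothesis is contradictory: the empty graph is a minor of every graph. *)
case: k hminor => [|h] hminor.
  by case: hminor; exists (fun _ => set0); split=> -[].
have -> : h.+1%:R - 1 = h%:R :> R by rewrite -natr1 addrK.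
rewrite -hDelta; apply: fractional_chromatic_number_le_dual => [|w w0].
  by rewrite !mulr_ge0 ?addr_ge0 ?ler0n.
exact: heavy_induced_matching.
Qed.
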